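(* Let $f$ be an increasing $(h-s)_1$-convex function on $I=[0,\infty)$, and let $g:[0,\infty)\to[0,\infty)$. If $g$ is convex on $I$, then the composition $f\circ g$ is $(h-s)_1$-convex on $I$.
   Context: Let $J\subseteq\mathbb{R}$ with $[0,1]\subseteq J$, let $h:J\to\mathbb{R}$ be a nonnegative function with $h\not\equiv 0$, and let $s\in(0,1]$. Write $h^s(t)=(h(t))^s$, and let $I=[0,\infty)$. A function $f:[0,\infty)\to\mathbb{R}$ is $(h-s)_1$-convex on $I$ (in the first sense), written $f\in SX((h-s)_1,I)$, if $f$ is nonnegative and for all $x,y\in I$ and $t\in[0,1]$, $$f(tx+(1-t)y)\le h^s(t)f(x)+(1-h^s(t))f(y).$$ *)

(* Defs.v *)
From mathcomp Require Import all_boot all_order all_algebra.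
From mathcomp Require Import all_classical all_reals all_analysis.

Set Implicit Arguments.
Unset Strict Implicit.
Unset Printing Implicit Defensive.

Import Order.TTheory GRing.Theory Num.Theory.
Import numFieldNormedType.Exports.

Local Open Scope classical_set_scope.
Local Open Scope ring_scope.

(* A function on a subset of the reals is a total function of which only the
   values on that subset are constrained. For h t >= 0 and s > 0, powR is the
   usual real power, with 0 `^ s = 0. *)
Definition hs1_convex (R : realType) (h : R -> R) (s : R) (I : set R)
    (f : R -> R) : Prop :=
  (forall x, I x -> 0 <= f x) /\
  (forall x y t, I x -> I y -> 0 <= t <= 1 ->
    f (t * x + (1 - t) * y) <= h t `^ s * f x + (1 - h t `^ s) * f y).

(* Main.v *)
Require Import Defs.
From mathcomp Require Import all_boot all_order all_algebra.
From mathcomp Require Import all_classical all_reals all_analysis.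

Import Order.TTheory GRing.Theory Num.Theory.
Import numFieldNormedType.Exports.

Local Open Scope classical_set_scope.
Local Open Scope ring_scope.

(** The argument has three monotone steps. Convexity of [g] puts
    [g (t x + (1 - t) y)] below [t g x + (1 - t) g y]. Both points lie in
    [[0, +oo[], because [g] is nonnegative there and a convex combination of
    nonnegative reals is nonnegative, so the monotone [f] preserves the
    comparison. Finally the [(h-s)_1]-convexity of [f], used at the points
    [g x] and [g y] of [[0, +oo[], bounds [f (t g x + (1 - t) g y)]. *)

Lemma conv_comb_ge0 (R : numDomainType) (x y t : R) :
  0 <= x -> 0 <= y -> 0 <= t <= 1 -> 0 <= t * x + (1 - t) * y.
Proof.
by move=> x0 y0 /andP[t0 t1]; rewrite addr_ge0 ?mulr_ge0 ?subr_ge0.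
Qed.

(** [convex_function] quantifies over weights bundled with their bounds; this
    unbundles it into the textbook inequality. *)
Lemma convex_function_le (R : realType) (A : set R) (g : R -> R) (x y t : R) :
  @convex_function R R^o A g -> A x -> A y -> 0 <= t <= 1 ->
  g (t * x + (1 - t) * y) <= t * g x + (1 - t) * g y.
Proof.
move=> g_conv Ax Ay /andP[t0 t1].
have := g_conv (Itv01 t0 t1) x y (mem_set Ax) (mem_set Ay).
by rewrite !convRE.
Qed.

Theorem theorem2p2 (R : realType) (J : set R) (h : R -> R) (s : R)
    (f g : R -> R)
    (J01 : `[0, 1] `<=` J)
    (h_ge0 : forall t, J t -> 0 <= h t)
    (h_neq0 : exists2 t, J t & h t != 0)
    (s01 : 0 < s <= 1)
    (f_incr : {in `[0, +oo[ &, {homo f : x y / x <= y}})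
    (f_conv : hs1_convex h s `[0, +oo[ f)
    (g_ge0 : forall x, 0 <= x -> 0 <= g x)
    (g_conv : @convex_function R R^o `[0, +oo[ g) :
  hs1_convex h s `[0, +oo[ (f \o g).
Proof.
have [f_ge0 f_le] := f_conv.
have pos x : `[0, +oo[%classic x -> 0 <= x by rewrite /= in_itv /= andbT.
have gI x : `[0, +oo[%classic x -> `[0, +oo[%classic (g x).
  by move=> /pos x0; rewrite /= in_itv /= andbT g_ge0.
split=> [x Ix|x y t Ix Iy t01]; first exact/f_ge0/gI.
apply: le_trans (f_le _ _ _ (gI _ Ix) (gI _ Iy) t01).
apply: f_incr; last exact: convex_function_le g_conv Ix Iy t01.
  by rewrite in_itv /= andbT g_ge0 // conv_comb_ge0 // pos.
by rewrite in_itv /= andbT conv_comb_ge0 // g_ge0 // pos.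
Qed.
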